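(* Let $\ell\ge3$, let $\mathcal{A}$ be a central arrangement in $\mathbb{K}^\ell$, $H\in\mathcal{A}$, $\mathcal{A}':=\mathcal{A}\setminus\{H\}$ and $\mathcal{A}^H:=\{H\cap L\mid L\in\mathcal{A}'\}$. Assume $\mathcal{A}'$ is free. If $g(\mathcal{A})\le\ell+2$, then $\mathcal{A}^H$ is free.
   Context: $S=\mathbb{K}[x_1,\ldots,x_\ell]$; $D(\mathcal{A})=\{\theta\in\bigoplus_iS\partial_{x_i}\mid\theta(\alpha_{H'})\in S\alpha_{H'}\ \forall H'\in\mathcal{A}\}$; for the restriction $\mathcal{A}^H$ (an arrangement in $H\cong\mathbb{K}^{\ell-1}$), $D(\mathcal{A}^H)$ is defined analogously over $S/\alpha_HS$. Free means the derivation module is free. $g(\mathcal{A})$ is the cardinality of a minimal homogeneous generating set of $D(\mathcal{A})$. *)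

(* Defs.v *)
From HB Require Import structures.
From mathcomp Require Import all_boot all_order all_algebra.
From mathcomp Require Import mpoly.

Set Implicit Arguments.
Unset Strict Implicit.
Unset Printing Implicit Defensive.

Import GRing.Theory.
Local Open Scope ring_scope.

(* Conventions.
   - A linear form on K^n is a row vector a : 'rV[K]_n, i.e. alpha = sum_i a_i x_i.
   - A central arrangement in K^n is a finite list of NONZERO linear forms
     (one defining form per hyperplane; duplicates/scalar multiples are
     harmless since D(A) only depends on the set of hyperplanes).
   - S = {mpoly K[n]}; a derivation theta = sum_i f_i d/dx_i is the
     function i |-> f_i. *)

Section Arr.
Variables (K : fieldType) (n : nat).

Definition deriv := {ffun 'I_n -> {mpoly K[n]}}.

Definition lform (a : 'rV[K]_n) : {mpoly K[n]} := \sum_(i < n) a 0 i *: 'X_i.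

Definition deriv_app (th : deriv) (a : 'rV[K]_n) : {mpoly K[n]} :=
  \sum_(i < n) a 0 i *: th i.

Definition central_arrangement (A : seq 'rV[K]_n) : Prop :=
  forall a, a \in A -> a != 0.

Definition inD (A : seq 'rV[K]_n) (th : deriv) : Prop :=
  forall a, a \in A -> exists q : {mpoly K[n]}, deriv_app th a = q * lform a.

Definition lincomb m (c : 'I_m -> {mpoly K[n]}) (B : 'I_m -> deriv) : deriv :=
  [ffun i => \sum_(j < m) c j * B j i].

Definition generates (A : seq 'rV[K]_n) m (B : 'I_m -> deriv) : Prop :=
  (forall j, inD A (B j)) /\
  (forall th, inD A th -> exists c, th = lincomb c B).

Definition free_arr (A : seq 'rV[K]_n) : Prop :=
  exists m (B : 'I_m -> deriv),
    generates A B /\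
    (forall c, lincomb c B = 0 -> forall j, c j = 0).

Definition homog_deriv (th : deriv) : Prop :=
  exists d : nat, forall i, th i \is d.-homog.

Definition minimal_homog_gen (A : seq 'rV[K]_n) m (B : 'I_m -> deriv) : Prop :=
  (forall j, homog_deriv (B j)) /\ generates A B /\
  (forall j0, ~ (forall th, inD A th ->
                   exists c, c j0 = 0 /\ th = lincomb c B)).

Definition g_le (A : seq 'rV[K]_n) (k : nat) : Prop :=
  exists m (B : 'I_m -> deriv), minimal_homog_gen A B /\ (m <= k)%N.

End Arr.

(* deletion A' = A \ {H}: remove every form defining H (i.e. proportional to aH) *)
Definition deletion (K : fieldType) n (A : seq 'rV[K]_n) (aH : 'rV[K]_n) :=
  [seq a <- A | ~~ (a <= aH)%MS].

(* restriction A^H, in coordinates: P : 'M_(n, n.-1) is a matrix whose columns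
   form a basis of H = ker aH, identifying K^(n-1) with H via v |-> P v;
   H cap L then corresponds to the form a_L *m P on K^(n-1). *)
Definition restriction (K : fieldType) n (A : seq 'rV[K]_n) (aH : 'rV[K]_n)
  (P : 'M[K]_(n, n.-1)) : seq 'rV[K]_(n.-1) :=
  [seq a *m P | a <- deletion A aH].

(* Main.v *)
Require Import Defs.
From HB Require Import structures.
From mathcomp Require Import all_boot all_order all_algebra.
From mathcomp Require Import mpoly.
From mathcomp Require Import perm ring zify.

(** Let alpha define H, V a basis of D(A') and S' = S / alpha S.  Evaluating V
    at alpha gives a vector of S'^l of the form b f, where b is Terao's
    polynomial, res Q(A') = Q(A^H) b up to a scalar.  The coefficient vectors,
    modulo alpha, of the elements of D(A) are the syzygies of f.  If F consists
    of l - 1 syzygies, the derivations of H that they induce have determinant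
    h Q(A^H), and the maximal minors of F are the entries of f times h and a
    unit.  By Saito's criterion it is enough to choose F with h(0) <> 0: the
    homogeneous components of the rows then contain a basis of D(A^H).

    Let C be the coefficients of the l + 2 generators of D(A) in the basis V,
    and write alpha V = E C V.  Differentiating E C = alpha I at the origin
    gives rank C(0) + rank E(0) >= l.  If rank C(0) >= l - 2, then l - 2
    combinations of the generators and one Koszul relation form F.  Otherwise
    rank E(0) >= 3 and, up to a linear change of generators, three of them are
    locally superfluous; the other l - 1 form F.  They generate the syzygies
    near 0, so by McCoy's theorem h divides a power of an element that does not
    vanish at 0. *)

Set Implicit Arguments.
Unset Strict Implicit.
Unset Printing Implicit Defensive.

Import GRing.Theory.
Local Open Scope ring_scope.

Local Notation cmx := (map_mx (@mpolyC _ _)).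
Local Notation "p @0" := (p@_0%MM) (at level 2, format "p @0").
Local Notation ev := (map_mx (mcoeff 0%MM)).

(** * Divisibility and McCoy's theorem *)

Section Divides.
Variable R : comNzRingType.
Implicit Types a b x y : R.

Definition divides a b := exists q, b = q * a.

Lemma divides_refl a : divides a a.
Proof. by exists 1; rewrite mul1r. Qed.

Lemma divides_mull x a b : divides a b -> divides a (x * b).
Proof. by case=> q ->; exists (x * q); rewrite mulrA. Qed.

Lemma divides_mulr x a b : divides a b -> divides a (b * x).
Proof. by rewrite mulrC; apply: divides_mull. Qed.

Lemma divides0 a : divides a 0.
Proof. by exists 0; rewrite mul0r. Qed.

Lemma dividesD a x y : divides a x -> divides a y -> divides a (x + y).
Proof. by case=> p -> [q ->]; exists (p + q); rewrite mulrDl. Qed.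

Lemma divides_trans b a c : divides a b -> divides b c -> divides a c.
Proof. by case=> p -> [q ->]; exists (q * p); rewrite mulrA. Qed.

Lemma divides_sum (I : finType) a (F : I -> R) :
  (forall i, divides a (F i)) -> divides a (\sum_i F i).
Proof.
by move=> h; elim/big_rec: _ => [|i x _]; [exact: divides0|exact/dividesD/h].
Qed.

(** Equality in [R] is decidable, so [xchoose] selects the quotients without an axiom of choice. *)
Lemma divides_choice (I : Type) a (F : I -> R) :
  (forall i, divides a (F i)) -> exists f, forall i, F i = f i * a.
Proof.
move=> dvdF; have h i : exists q, F i == q * a.
  by have [q ->] := dvdF i; exists q.
by exists (fun i => xchoose (h i)) => i; apply/eqP/(xchooseP (h i)).
Qed.

End Divides.

Section McCoy.
Variables (R : comNzRingType) (m n : nat) (C : 'M[R]_(m, n)) (h d : R).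
Hypothesis dvd_coef : forall c : 'rV_m,
  (forall j, divides h ((c *m C) 0 j)) -> forall i, divides h (d * c 0 i).
Hypothesis dvd_minor : forall g : 'I_m -> 'I_n, divides h (\det (colsub g C)).

(* The cofactors of a t-minor inside its (t+1)-minors are the coefficients of
   a row combination all of whose entries are (t+1)-minors. *)
Lemma mccoy_descent s t (le_tm : (t <= m)%N) : (t + s)%N = m ->
  exists e, forall g : 'I_t -> 'I_n,
    divides h (d ^+ e * \det (mxsub (widen_ord le_tm) g C)).
Proof.
elim: s t le_tm => [|s IHs] t le_tm.
  rewrite addn0 => def_t; exists 0 => g; rewrite expr0 mul1r.
  case: m / def_t C dvd_minor le_tm => C0 hC le_tm.
  have -> : mxsub (widen_ord le_tm) g C0 = colsub g C0; last exact: hC.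
  by apply/matrixP=> i j; rewrite !mxE; congr (C0 _ _); apply: val_inj.
rewrite addnS -addSn => def_m.
have lt_tm : (t < m)%N by rewrite -def_m leq_addr.
have [e he] := IHs _ lt_tm def_m; exists e.+1 => g.
pose w := widen_ord lt_tm.
pose v (i : 'I_t.+1) := (-1) ^+ (i + t) * \det (mxsub (w \o lift i) g C).
pose u : 'rV_m := \row_i \sum_(i' | w i' == i) v i'.
(* [B j] adjoins column [j] of [C] to the columns [g]; expanding its determinant along this last
   column gives entry [j] of [u *m C]. *)
pose B j := mxsub w (fun k => if unlift ord_max k is Some k' then g k' else j) C.
have uC j : (u *m C) 0 j = \det (B j).
  rewrite mxE (expand_det_col _ ord_max) [RHS](partition_big w xpredT) //=.
  apply: eq_bigr => i _; rewrite mxE mulr_suml; apply: eq_bigr => i' /eqP <-.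
  rewrite mulrC mxE unlift_none; congr (_ * _); rewrite /cofactor /v.
  congr (_ * \det _); apply/matrixP=> a b.
  by rewrite !mxE liftK.
have winj : injective w by move=> a b /(congr1 val) /= /val_inj.
have hu j : divides h ((d ^+ e *: u *m C) 0 j).
  by rewrite -scalemxAl mxE uC; apply: he.
have := dvd_coef hu (w ord_max).
rewrite !mxE (big_pred1 ord_max) => [|i]; last by rewrite /= (inj_eq winj).
rewrite /v /= addnn -muln2 mulnC exprM expr2 mulrNN mulr1 expr1n mul1r.
rewrite mulrA -exprS.
suff -> : mxsub (w \o lift ord_max) g C = mxsub (widen_ord le_tm) g C by [].
apply/matrixP=> a b; rewrite !mxE; congr (C _ _); apply: val_inj.
exact: lift_max.
Qed.

(** In R/hR the hypotheses say that the maximal minors of [C] vanish and that [d] annihilates its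
    left kernel. The descent ends at the minor of size 0, which is 1, so [d] is nilpotent there. *)
Lemma mccoy : exists e, divides h (d ^+ e).
Proof.
have [e he] := mccoy_descent (leq0n m) (add0n m); exists e.
by move: (he (widen_ord (leq0n n))); rewrite det_mx00 mulr1.
Qed.

End McCoy.

Lemma det_colsub_noninj (R : comNzRingType) m n (A : 'M[R]_(m, n))
    (g : 'I_m -> 'I_n) : ~ injective g -> \det (colsub g A) = 0.
Proof.
move=> /injectiveP/injectivePn[i [j neq_ij eq_g]].
rewrite -det_tr; apply: (determinant_alternate neq_ij) => k.
by rewrite !mxE eq_g.
Qed.

Definition lfree (R : comNzRingType) m n (A : 'M[R]_(m, n)) :=
  forall c : 'rV_m, c *m A = 0 -> c = 0.

(** McCoy's theorem for h = 0 and d = 1: with more rows than columns every maximal minor repeats a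
    column, hence is 0, and 1 = 0 would follow. *)
Lemma lfree_leq (R : comNzRingType) m n (A : 'M[R]_(m, n)) :
  lfree A -> (m <= n)%N.
Proof.
move=> freeA; rewrite leqNgt; apply/negP=> lt_nm.
have [|g|e [q]] := @mccoy R m n A 0 1.
- move=> c hc i; have -> : c = 0; last by rewrite mxE mulr0; apply: divides0.
  apply/freeA/matrixP=> a j; rewrite ord1 [RHS]mxE.
  by have [q ->] := hc j; rewrite mulr0.
- rewrite det_colsub_noninj; first exact: divides0.
  by move=> /leq_card; rewrite !card_ord leqNgt lt_nm.
by rewrite expr1n mulr0 => /eqP; rewrite oner_eq0.
Qed.

Lemma scalemx_inj (R : idomainType) m n (d : R) (A B : 'M[R]_(m, n)) :
  d != 0 -> d *: A = d *: B -> A = B.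
Proof.
move=> d0 /matrixP eqAB; apply/matrixP=> i j; apply: (mulfI d0).
by have := eqAB i j; rewrite !mxE.
Qed.

Lemma lfree_det (R : idomainType) m (V : 'M[R]_m) : \det V != 0 -> lfree V.
Proof.
move=> dV c /(congr1 (mulmx^~ (\adj V))); rewrite /= -mulmxA mul_mx_adj mul0mx.
by rewrite mul_mx_scalar -[RHS](scaler0 _ (\det V)) => /(scalemx_inj dV).
Qed.

Lemma lfree_inj (R : comNzRingType) m n p (A : 'M[R]_(m, n)) (X Y : 'M_(p, m)) :
  lfree A -> X *m A = Y *m A -> X = Y.
Proof.
move=> freeA eqXY; apply/eqP; rewrite -subr_eq0; apply/eqP/row_matrixP=> i.
by rewrite row0; apply: freeA; rewrite -row_mul mulmxBl eqXY subrr row0.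
Qed.

(** * Linear forms and linear substitutions *)

Lemma mpoly_ring_ind (K : fieldType) n (P : {mpoly K[n]} -> Prop) :
  (forall c, P c%:MP) -> (forall i, P 'X_i) ->
  (forall p q, P p -> P q -> P (p + q)) ->
  (forall p q, P p -> P q -> P (p * q)) -> forall p, P p.
Proof.
move=> PC PX PD PM p; elim/mpolyind: p => [|c m p _ _ IH].
  by rewrite -mpolyC0.
apply: PD => //; rewrite -mul_mpolyC; apply: (PM _ _ (PC c)).
rewrite mpolyXE_id; elim/big_rec: _ => [|i q _ Pq]; first by rewrite -mpolyC1.
apply: (PM) => //; elim: (m i) => [|e IHe]; first by rewrite expr0 -mpolyC1.
by rewrite exprS; apply: (PM).
Qed.

Section LinearSubstitution.
Variable K : fieldType.

Definition lsub n k (M : 'M[K]_(n, k)) : {mpoly K[n]} -> {mpoly K[k]} :=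
  comp_mpoly [tuple lform (row i M) | i < n].

HB.instance Definition _ n k (M : 'M[K]_(n, k)) :=
  GRing.RMorphism.on (lsub M).
HB.instance Definition _ n k (M : 'M[K]_(n, k)) :=
  GRing.Linear.on (lsub M).

Lemma lsubC n k (M : 'M[K]_(n, k)) c : lsub M c%:MP = c%:MP.
Proof. exact: comp_mpolyC. Qed.

Lemma lsubX n k (M : 'M[K]_(n, k)) i : lsub M 'X_i = lform (row i M).
Proof. by rewrite /lsub comp_mpolyXU -tnth_nth tnth_mktuple. Qed.

Lemma lformD n (a b : 'rV[K]_n) : lform (a + b) = lform a + lform b.
Proof.
by rewrite /lform -big_split; apply: eq_bigr => i _; rewrite mxE scalerDl.
Qed.

Lemma lformZ n c (a : 'rV[K]_n) : lform (c *: a) = c *: lform a.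
Proof.
by rewrite /lform scaler_sumr; apply: eq_bigr => i _; rewrite mxE scalerA.
Qed.

Lemma lform0 n : lform (0 : 'rV[K]_n) = 0.
Proof. by rewrite /lform big1 // => i _; rewrite mxE scale0r. Qed.

Lemma lform_sum n (I : finType) (F : I -> 'rV[K]_n) :
  lform (\sum_i F i) = \sum_i lform (F i).
Proof. exact: (big_morph _ (@lformD n) (@lform0 n)). Qed.

Lemma lform_delta n i : lform (delta_mx 0 i : 'rV[K]_n) = 'X_i.
Proof.
rewrite /lform (bigD1 i) //= mxE !eqxx scale1r big1 ?addr0 // => j ne_ji.
by rewrite mxE eqxx (negPf ne_ji) scale0r.
Qed.

Lemma lsub_lform n k (M : 'M[K]_(n, k)) a :
  lsub M (lform a) = lform (a *m M).
Proof.
rewrite mulmx_sum_row lform_sum {1}/lform linear_sum; apply: eq_bigr => i _.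
by rewrite linearZ /= lsubX lformZ.
Qed.

Lemma lsub_comp n k l (M : 'M[K]_(n, k)) (N : 'M[K]_(k, l)) p :
  lsub N (lsub M p) = lsub (M *m N) p.
Proof.
elim/mpoly_ring_ind: p => [c|i|p q hp hq|p q hp hq].
- by rewrite !lsubC.
- by rewrite !lsubX lsub_lform row_mul.
- by rewrite !rmorphD /= hp hq.
- by rewrite !rmorphM /= hp hq.
Qed.

Lemma lsub1 n p : lsub (1%:M : 'M[K]_n) p = p.
Proof.
elim/mpoly_ring_ind: p => [c|i|p q hp hq|p q hp hq].
- by rewrite lsubC.
- by rewrite lsubX row1 lform_delta.
- by rewrite rmorphD /= hp hq.
- by rewrite rmorphM /= hp hq.
Qed.

Lemma lsub_congr n k (M M' : 'M[K]_(n, k)) v a p :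
  M = M' + v *m a -> divides (lform a) (lsub M p - lsub M' p).
Proof.
move=> ->; elim/mpoly_ring_ind: p => [c|i|p q hp hq|p q hp hq].
- by rewrite !lsubC subrr; apply: divides0.
- rewrite !lsubX linearD /= lformD addrC addKr row_mul.
  rewrite (mx11_scalar (row i v)) mul_scalar_mx lformZ -mul_mpolyC.
  by eexists.
- by rewrite !rmorphD /= opprD addrACA; apply: dividesD.
- rewrite !rmorphM /=.
  set x := lsub _ p; set y := lsub _ q; set x' := lsub _ p; set y' := lsub _ q.
  have -> : x * y - x' * y' = (x - x') * y + x' * (y - y').
    by rewrite mulrBl mulrBr addrA subrK.
  by apply: dividesD; [apply: divides_mulr|apply: divides_mull].
Qed.

Lemma lform_coeff n (a : 'rV[K]_n) i : (lform a)@_U_(i) = a 0 i.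
Proof.
rewrite /lform raddf_sum /= (bigD1 i) //= mcoeffZ mcoeffXU eqxx mulr1.
rewrite big1 ?addr0 // => j ne_ji; rewrite mcoeffZ mcoeffXU.
by rewrite (negPf ne_ji) mulr0.
Qed.

Lemma lform_eq0 n (a : 'rV[K]_n) : (lform a == 0) = (a == 0).
Proof.
apply/eqP/eqP=> [la0|->]; last exact: lform0.
by apply/rowP=> i; rewrite -lform_coeff la0 mcoeff0 mxE.
Qed.

Lemma dhomog_lform n (a : 'rV[K]_n) : lform a \is 1.-homog.
Proof. by apply: rpred_sum => i _; apply: rpredZ; rewrite dhomogX /= mdeg1. Qed.

Lemma mcoeff0_lform n (a : 'rV[K]_n) : (lform a)@_0%MM = 0.
Proof. by apply: (dhomog_nemf_coeff (dhomog_lform a)); rewrite /= mdeg0. Qed.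

Lemma lsub_mcoeff0 n k (M : 'M[K]_(n, k)) p : (lsub M p)@_0%MM = p@_0%MM.
Proof.
elim/mpoly_ring_ind: p => [c|i|p q hp hq|p q hp hq].
- by rewrite lsubC !mcoeffC !eqxx.
- by rewrite lsubX mcoeff0_lform mcoeffX mnm1_eq0.
- by rewrite rmorphD !mcoeffD hp hq.
- by rewrite rmorphM !rmorphM /= hp hq.
Qed.

Lemma row_neq0_free n (a : 'rV[K]_n) : a != 0 -> row_free a.
Proof. by move=> a0; rewrite /row_free rank_rV a0. Qed.

Definition hyp_proj n (a : 'rV[K]_n) : 'M[K]_n := 1%:M - pinvmx a *m a.

(** Substituting [hyp_proj a] kills [lform a] and changes a polynomial only modulo [lform a]. As the
    target is a domain, nonzero linear forms are prime. *)
Lemma divides_lformP n (a : 'rV[K]_n) p : a != 0 ->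
  divides (lform a) p <-> lsub (hyp_proj a) p = 0.
Proof.
move=> a0; split=> [[q ->]|hp].
  rewrite rmorphM /= lsub_lform /hyp_proj mulmxBr mulmx1 mulmxA.
  by rewrite mulmxVp ?row_neq0_free // mul1mx subrr lform0 mulr0.
rewrite -[p]lsub1 -[X in divides _ X]subr0 -hp.
by apply: (@lsub_congr _ _ _ _ (pinvmx a)); rewrite /hyp_proj subrK.
Qed.

Lemma divides_lformM n (a : 'rV[K]_n) p q : a != 0 ->
  divides (lform a) (p * q) -> divides (lform a) p \/ divides (lform a) q.
Proof.
move=> a0 /(divides_lformP _ a0); rewrite rmorphM => /eqP.
by rewrite mulf_eq0 => /orP[]/eqP h; [left|right]; apply/divides_lformP.
Qed.

Lemma divides_lform_lform n (a b : 'rV[K]_n) : a != 0 ->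
  divides (lform a) (lform b) -> (b <= a)%MS.
Proof.
move=> a0 /(divides_lformP _ a0)/eqP.
rewrite lsub_lform lform_eq0 /hyp_proj mulmxBr mulmx1 subr_eq0 => /eqP ->.
by rewrite mulmxA submxMl.
Qed.

Lemma divides_lformX n (a : 'rV[K]_n) p e : a != 0 ->
  divides (lform a) (p ^+ e) -> divides (lform a) p \/ divides (lform a) 1.
Proof.
move=> a0; elim: e => [|e IHe]; first by rewrite expr0; right.
by rewrite exprS => /(divides_lformM a0)[]; [left|].
Qed.

Lemma divides_lform1 n (a : 'rV[K]_n) : ~ divides (lform a) 1.
Proof.
case=> q /(congr1 (mcoeff 0%MM)); rewrite rmorphM /= mcoeff0_lform mulr0.
by rewrite rmorph1 => /eqP; rewrite oner_eq0.
Qed.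

Lemma lform_pow_cancel n (a : 'rV[K]_n) p q e : a != 0 ->
  ~ divides (lform a) p -> divides (lform a ^+ e) (p * q) ->
  divides (lform a ^+ e) q.
Proof.
move=> a0 npa; elim: e q => [|e IHe] q; first by exists q; rewrite expr0 mulr1.
move=> h; have : divides (lform a) (p * q).
  by apply: divides_trans h; exists (lform a ^+ e); rewrite exprSr mulrC.
case/(divides_lformM a0)=> // -[q' def_q]; move: h; rewrite def_q mulrA exprSr.
case=> r; rewrite [RHS]mulrA => /mulIf e_pq.
have /IHe[s ->] : divides (lform a ^+ e) (p * q').
  by exists r; apply: e_pq; rewrite lform_eq0.
by exists s; rewrite mulrA.
Qed.

Definition nonprop n (s : seq 'rV[K]_n) :=
  pairwise (fun a b => ~~ (a <= b)%MS) s.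

Lemma prop_sym n (a b : 'rV[K]_n) : a != 0 -> (a <= b)%MS -> (b <= a)%MS.
Proof.
move=> a0 /sub_rVP[c def_a]; apply/sub_rVP; exists c^-1.
have c0 : c != 0 by apply: contra_neq a0 => c0; rewrite def_a c0 scale0r.
by rewrite def_a scalerA mulVf // scale1r.
Qed.

Lemma prod_lform_pow_divides n (s : seq 'rV[K]_n) (e : 'rV[K]_n -> nat) p :
  {in s, forall a, a != 0} -> nonprop s ->
  {in s, forall a, divides (lform a ^+ e a) p} ->
  divides (\prod_(a <- s) lform a ^+ e a) p.
Proof.
rewrite /nonprop; elim: s p => [|a s IHs] p s0 /=.
  by move=> _ _; exists p; rewrite big_nil mulr1.
case/andP=> /allP npa nps dvdp; have [q def_p] := dvdp a (mem_head _ _).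
have s0' : {in s, forall b, b != 0}.
  by move=> b bs; apply: s0; rewrite inE bs orbT.
have dvdq : {in s, forall b, divides (lform b ^+ e b) q}.
  move=> b bs; have b0 := s0' b bs.
  apply: (@lform_pow_cancel _ _ (lform a ^+ e a)) => //.
    case/(divides_lformX b0) => [|/divides_lform1//].
    by move=> /(divides_lform_lform b0); apply/negP/npa.
  by rewrite mulrC -def_p; apply: dvdp; rewrite inE bs orbT.
have [r def_q] := IHs q s0' nps dvdq.
by exists r; rewrite big_cons def_p def_q mulrAC mulrA.
Qed.

Lemma prod_lform_divides n (s : seq 'rV[K]_n) p :
  {in s, forall a, a != 0} -> nonprop s ->
  {in s, forall a, divides (lform a) p} ->
  divides (\prod_(a <- s) lform a) p.
Proof.
move=> s0 nps h.
have := @prod_lform_pow_divides _ s (fun=> 1%N) p s0 nps.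
under eq_bigr do rewrite expr1.
by apply=> a /h; rewrite expr1.
Qed.

(** A list may repeat a hyperplane, while Saito's criterion needs a reduced defining polynomial;
    hence one form is kept from each class of proportional forms. *)
Lemma exists_nonprop n (A : seq 'rV[K]_n) : exists A0,
  [/\ nonprop A0, {subset A0 <= A}
    & {in A, forall a, exists2 b, b \in A0 & (a <= b)%MS}].
Proof.
elim: A => [|a A [A0 [np sub cov]]]; first by exists [::]; split.
have [/hasP[b bA0 le_ab]|nab] := boolP (has (fun b => (a <= b)%MS) A0).
  exists A0; split=> // [b' /sub|c]; first by rewrite inE orbC => ->.
  by rewrite inE => /predU1P[->|/cov//]; exists b.
exists (a :: A0); split.
- by apply/andP; split; [rewrite all_predC|].
- by move=> b; rewrite !inE => /predU1P[->|/sub->]; rewrite ?eqxx ?orbT.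
- move=> c; rewrite inE => /predU1P[->|/cov[b bA0 le_cb]].
    by exists a; rewrite ?mem_head.
  by exists b; rewrite // inE bA0 orbT.
Qed.

Lemma pihomog_split n (p : {mpoly K[n]}) :
  exists N, p = \sum_(d < N.+1) pihomog mdeg d p.
Proof. by eexists; apply: pihomog_partitionE; apply: leqnSn. Qed.

Lemma pihomog_divides n d e (p q : {mpoly K[n]}) :
  q \is e.-homog -> divides q p -> divides q (pihomog mdeg d p).
Proof.
move=> hq [r ->]; have [N ->] := pihomog_split r.
rewrite mulr_suml linear_sum; apply: divides_sum => i /=.
have h := dhomogM (pihomogP mdeg i r) hq.
have [eq_d|ne_d] := eqVneq (i + e)%N d.
  by rewrite -eq_d (pihomog_dE h); exists (pihomog mdeg i r).
by rewrite (pihomog_ne0 ne_d) //; apply: divides0.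
Qed.

Lemma pihomog0_const n (p : {mpoly K[n]}) :
  pihomog mdeg 0 p = (p@_0%MM)%:MP.
Proof.
have -> : p@_0%MM = (pihomog mdeg 0 p)@_0%MM.
  have [N def_p] := pihomog_split p; rewrite {1}def_p raddf_sum /=.
  rewrite big_ord_recl /= big1 ?addr0 // => i _.
  by apply: (dhomog_nemf_coeff (pihomogP _ _ _)); rewrite /= mdeg0.
apply/mpolyP=> m; rewrite mcoeffC; have [->|m0] := eqVneq m 0%MM.
  by rewrite mulr1.
rewrite mulr0.
by apply: (dhomog_nemf_coeff (pihomogP _ _ _)); rewrite /= mdeg_eq0.
Qed.

(** The component of degree e of h q is h(0) q, which is nonzero; as h q is homogeneous, it equals
    this component. *)
Lemma homog_cofactor_const n d e (q h : {mpoly K[n]}) :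
  q != 0 -> q \is e.-homog -> h * q \is d.-homog -> h@_0%MM != 0 ->
  h = (h@_0%MM)%:MP.
Proof.
move=> q0 hq hp h0.
have def_e : pihomog mdeg e (h * q) = (h@_0%MM)%:MP * q.
  have [N def_h] := pihomog_split h; rewrite {1}def_h mulr_suml.
  rewrite linear_sum big_ord_recl /= big1 ?addr0 => [|i _].
    rewrite pihomog0_const pihomog_dE //.
    by rewrite mul_mpolyC; apply: rpredZ.
  apply: pihomog_ne0 (dhomogM (pihomogP _ _ _) hq).
  by rewrite /= -[X in _ != X](add0n e) (inj_eq (@addIn e)).
have [eq_de|ne_de] := eqVneq d e.
  by apply: (mulIf q0); rewrite -def_e -eq_de pihomog_dE.
move: def_e; rewrite (pihomog_ne0 ne_de) // => /esym/eqP.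
by rewrite mulf_eq0 (negPf q0) orbF mpolyC_eq0 (negPf h0).
Qed.

End LinearSubstitution.

(** * Saito's criterion *)

Section LogDerivations.
Variables (K : fieldType) (n : nat).
Local Notation S := {mpoly K[n]}.
Implicit Types (A : seq 'rV[K]_n) (a : 'rV[K]_n).

(* The rows of V are logarithmic derivations, in the basis d/dx_i. *)
Definition logmx A m (V : 'M[S]_(m, n)) :=
  forall a, a \in A -> forall i, divides (lform a) ((V *m cmx a^T) i 0).

Definition defpoly A : S := \prod_(a <- A) lform a.

Lemma logmxM A m p (W : 'M[S]_(p, m)) V : logmx A V -> logmx A (W *m V).
Proof.
move=> hV a aA i; rewrite -mulmxA mxE; apply: divides_sum => j.
by apply: divides_mull; apply: hV.
Qed.

Lemma logmx_row A m (V : 'M[S]_(m, n)) :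
  (forall i, logmx A (row i V)) -> logmx A V.
Proof. by move=> hV a aA i; have := hV i a aA 0; rewrite -row_mul mxE. Qed.

Lemma logmx_sub A B m (V : 'M[S]_(m, n)) :
  {subset A <= B} -> logmx B V -> logmx A V.
Proof. by move=> sub hV a /sub/hV. Qed.

Lemma logmx_cover A A0 m (V : 'M[S]_(m, n)) :
  {in A, forall a, exists2 b, b \in A0 & (a <= b)%MS} ->
  logmx A0 V -> logmx A V.
Proof.
move=> cov hV a /cov[b /hV hb /sub_rVP[c ->]] i; have [q def_q] := hb i.
exists q; rewrite linearZ /= map_mxZ -scalemxAr mxE def_q lformZ.
by rewrite -mul_mpolyC mulrCA.
Qed.

Lemma inD_logmx A (th : Defs.deriv K n) : inD A th <-> logmx A (\row_i th i).
Proof.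
have E a : ((\row_i th i) *m cmx a^T) 0 0 = deriv_app th a.
  rewrite /deriv_app mxE; apply: eq_bigr => i _.
  by rewrite !mxE -mul_mpolyC mulrC.
split=> h a aA; first by move=> i; rewrite ord1 E; apply: h.
by rewrite -E; apply: h.
Qed.

Lemma defpoly_neq0 A : {in A, forall a, a != 0} -> defpoly A != 0.
Proof.
move=> A0; rewrite /defpoly prodf_seq_neq0; apply/allP=> a /A0 /=.
by rewrite lform_eq0.
Qed.

Lemma defpoly_homog A : defpoly A \is (size A).-homog.
Proof.
rewrite /defpoly; elim: A => [|a A IHA]; first by rewrite big_nil dhomog1.
by rewrite big_cons; apply: (dhomogM (dhomog_lform a) IHA).
Qed.

(** Multiplying [V *m cmx a^T] by the adjugate shows that [lform a] divides det V times each
    coefficient of [a], one of which is invertible. *)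
Lemma lform_divides_det A a (V : 'M[S]_n) :
  logmx A V -> a \in A -> a != 0 -> divides (lform a) (\det V).
Proof.
move=> hV aA /rV0Pn[i ai0].
have : divides (lform a) ((\det V) * (a 0 i)%:MP).
  have -> : \det V * (a 0 i)%:MP = (\adj V *m (V *m cmx a^T)) i 0.
    by rewrite mulmxA mul_adj_mx mul_scalar_mx !mxE.
  by rewrite mxE; apply: divides_sum => j; apply/divides_mull/hV.
move/(divides_mulr (a 0 i)^-1%:MP).
by rewrite -mulrA -mpolyCM mulfV // mpolyC1 mulr1.
Qed.

Lemma defpoly_divides_det A (V : 'M[S]_n) :
  {in A, forall a, a != 0} -> nonprop A -> logmx A V ->
  divides (defpoly A) (\det V).
Proof.
move=> A0 npA hV; apply: prod_lform_divides => // a aA.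
exact: lform_divides_det hV aA (A0 a aA).
Qed.

(** Cramer's rule: entry [j] of [v *m \adj V] is the determinant of [V] with row [j] replaced by
    [v]. This matrix is again logarithmic, so the entry is divisible by [defpoly A], which is det V
    up to a scalar. *)
Lemma saito_generates A (V : 'M[S]_n) c :
  {in A, forall a, a != 0} -> nonprop A -> logmx A V ->
  c != 0 -> \det V = c%:MP * defpoly A ->
  forall v : 'rV[S]_n, logmx A v -> exists w : 'rV[S]_n, v = w *m V.
Proof.
move=> A0 npA hV c0 dV v hv.
have hW j : divides (defpoly A) ((v *m \adj V) 0 j).
  pose Vj := \matrix_(i, k) if i == j then v 0 k else V i k.
  have hVj : logmx A Vj.
    apply: logmx_row => i; have [->|ne_ij] := eqVneq i j.
      suff -> : row j Vj = v by [].
      by apply/rowP=> k; rewrite !mxE eqxx.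
    suff -> : row i Vj = row i V by rewrite rowE; apply: logmxM.
    by apply/rowP=> k; rewrite !mxE (negPf ne_ij).
  have [q def_q] := defpoly_divides_det A0 npA hVj; exists q; rewrite -def_q.
  rewrite (expand_det_row _ j) mxE; apply: eq_bigr => k _.
  rewrite !mxE eqxx /cofactor; congr (_ * (_ * \det _)).
  by apply/matrixP=> x y; rewrite !mxE eq_sym (negPf (neq_lift _ _)).
have [f def_f] := divides_choice hW; pose W := \row_j f j.
have def_W : v *m \adj V = defpoly A *: W.
  by apply/rowP=> j; rewrite def_f !mxE mulrC.
exists (c^-1%:MP *: W); apply: (@scalemx_inj _ _ _ (\det V)).
  by rewrite dV mulf_neq0 ?defpoly_neq0 // mpolyC_eq0.
rewrite -mul_mx_scalar -mul_adj_mx mulmxA def_W -!scalemxAl !scalerA dV.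
by rewrite mulrAC -mpolyCM mulfV // mpolyC1 mul1r.
Qed.

Lemma saito_free A A0 (V : 'M[S]_n) c :
  {in A0, forall a, a != 0} -> nonprop A0 -> {subset A0 <= A} ->
  {in A, forall a, exists2 b, b \in A0 & (a <= b)%MS} ->
  logmx A0 V -> c != 0 -> \det V = c%:MP * defpoly A0 -> free_arr A.
Proof.
move=> nzA0 npA0 sub cov hV c0 dV.
exists n, (fun i => [ffun j => V i j]).
have lc (w : 'rV[S]_n) :
    lincomb (fun i => w 0 i) (fun i => [ffun j => V i j])
      = [ffun j => (w *m V) 0 j].
  by apply/ffunP=> j; rewrite !ffunE mxE; apply: eq_bigr => i _; rewrite ffunE.
split; first split.
- move=> i; apply/inD_logmx/(logmx_cover cov).
  suff -> : \row_j [ffun j => V i j] j = row i V by rewrite rowE; apply: logmxM.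
  by apply/rowP=> j; rewrite !mxE ffunE.
- move=> th /inD_logmx/(logmx_sub sub)/(saito_generates nzA0 npA0 hV c0 dV)[w].
  move=> def_w; exists (fun i => w 0 i); rewrite lc -def_w.
  by apply/ffunP=> j; rewrite ffunE mxE.
move=> w; have -> : lincomb w (fun i => [ffun j => V i j])
    = [ffun j => ((\row_i w i) *m V) 0 j].
  rewrite -lc; apply/ffunP=> j; rewrite !ffunE; apply: eq_bigr => i _.
  by rewrite mxE.
move=> /ffunP wV0 j; have dV0 : \det V != 0.
  by rewrite dV mulf_neq0 ?defpoly_neq0 // mpolyC_eq0.
have /(lfree_det dV0)/rowP/(_ j) : (\row_i w i) *m V = 0.
  by apply/rowP=> k; have := wV0 k; rewrite !ffunE => ->; rewrite mxE.
by rewrite !mxE.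
Qed.

Lemma det_row_sum m N (F : 'I_N -> 'M[S]_m) :
  \det (\sum_d F d) =
  \sum_(g : {ffun 'I_m -> 'I_N}) \det (\matrix_(i, j) F (g i) i j).
Proof.
rewrite /determinant exchange_big /=; apply: eq_bigr => s _.
rewrite -mulr_sumr; congr (_ * _).
under eq_bigr do rewrite summxE.
rewrite bigA_distr_bigA; apply: eq_bigr => g _; apply: eq_bigr => i _.
by rewrite mxE.
Qed.

Lemma dhomog_det m (d : 'I_m -> nat) (V : 'M[S]_m) :
  (forall i j, V i j \is (d i).-homog) ->
  \det V \is (\sum_i d i)%N.-homog.
Proof.
move=> hV; apply: rpred_sum => s _; rewrite -signr_odd.
have h : \prod_i V i (s i) \is (\sum_i d i)%N.-homog.
  by elim/big_rec2: _ => [|i x y _ hx]; [exact: dhomog1|exact: dhomogM].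
by case: (odd _); rewrite ?expr0 ?mul1r // expr1 mulN1r dhomogN.
Qed.

(* Expand det V over the homogeneous components of the rows: every term is a
   multiple of defpoly A, and one with a constant nonzero multiple survives. *)
Lemma saito_local A (V : 'M[S]_n) h :
  {in A, forall a, a != 0} -> nonprop A -> logmx A V ->
  \det V = h * defpoly A -> h@0 != 0 ->
  exists V' c, [/\ logmx A V', c != 0 & \det V' = c%:MP * defpoly A].
Proof.
move=> nzA npA hV dV h0.
have [N defV] : exists N, V = \sum_(d < N) map_mx (pihomog mdeg d) V.
  pose N := \max_i \max_j (mmeasure mdeg (V i j)); exists N.
  apply/matrixP=> i j; rewrite summxE.
  rewrite {1}(@pihomog_partitionE _ _ mdeg N (V i j)) //.
    by apply: eq_bigr => d _; rewrite mxE.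
  by apply: leq_trans (leq_bigmax i); apply: (leq_bigmax (F := fun j => _) j).
pose W (g : {ffun 'I_n -> 'I_N}) :=
  \matrix_(i, j) map_mx (pihomog mdeg (g i)) V i j.
have logW g : logmx A (W g).
  move=> a aA i; have := pihomog_divides (g i) (dhomog_lform a) (hV a aA i).
  congr (divides _ _); rewrite !mxE linear_sum; apply: eq_bigr => j _ /=.
  by rewrite !mxE mulrC [RHS]mulrC !mul_mpolyC linearZ.
have [q Wq] := divides_choice (fun g => defpoly_divides_det nzA npA (logW g)).
have [g qg0] : exists g, (q g)@0 != 0.
  apply/existsP; apply: contraNT h0; rewrite negb_exists => /forallP q0.
  suff -> : h = \sum_g q g.
    by rewrite raddf_sum big1 // => g _; have := q0 g; rewrite negbK => /eqP.
  apply: (mulIf (defpoly_neq0 nzA)); rewrite -dV {1}defV det_row_sum mulr_suml.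
  by apply: eq_bigr => g _; rewrite -Wq.
exists (W g), (q g)@0; split=> //.
rewrite Wq; congr (_ * _).
apply: (homog_cofactor_const (defpoly_neq0 nzA) (defpoly_homog A) _ qg0).
rewrite -Wq; apply: dhomog_det => i j; rewrite !mxE.
exact: pihomogP.
Qed.

End LogDerivations.

(** * Bases of free arrangements *)

Lemma rows_choice (R : nzRingType) m n p (W : 'M[R]_(p, n)) (V : 'M[R]_(m, n)) :
  (forall i, exists w : 'rV_m, row i W = w *m V) -> exists Z, W = Z *m V.
Proof.
move=> hW; have h i : exists w : 'rV_m, row i W == w *m V.
  by have [w ->] := hW i; exists w.
exists (\matrix_i xchoose (h i)); apply/row_matrixP=> i.
by rewrite row_mul rowK; apply/eqP/(xchooseP (h i)).
Qed.

(** Both block products factor the same matrix of size 1 + n, once through each Schur complement. *)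
Lemma det_rank1_update (R : comNzRingType) n (x : 'cV[R]_n) (y : 'rV[R]_n) :
  \det (1%:M + x *m y) = 1 + (y *m x) 0 0.
Proof.
have e1 : block_mx 1%:M 0 x 1%:M *m block_mx 1%:M (- y) 0 (1%:M + x *m y)
    = block_mx 1%:M (- y) x 1%:M :> 'M_(1 + n).
  rewrite mulmx_block !mul1mx !mul0mx !mulmx1 mulmxN !addr0.
  by rewrite addrC addrK.
have e2 : block_mx 1%:M (- y) 0 1%:M *m block_mx (1%:M + y *m x) 0 x 1%:M
    = block_mx 1%:M (- y) x 1%:M :> 'M_(1 + n).
  by rewrite mulmx_block !mul1mx !mul0mx !mulmx1 mulNmx addrK !add0r.
have := congr1 determinant e1; rewrite -e2 !det_mulmx !det_lblock !det_ublock.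
by rewrite !det1 !mul1r mulr1 => ->; rewrite det_mx11 !mxE eqxx.
Qed.

Section FreeBasis.
Variables (K : fieldType) (n : nat).
Local Notation S := {mpoly K[n]}.
Implicit Types (A : seq 'rV[K]_n) (a : 'rV[K]_n).

Lemma divides_lform_prod a (s : seq 'rV[K]_n) : a != 0 ->
  divides (lform a) (defpoly s) -> exists2 b, b \in s & (b <= a)%MS.
Proof.
move=> a0; rewrite /defpoly; elim: s => [|b s IHs].
  by rewrite big_nil => /divides_lform1.
rewrite big_cons => /(divides_lformM a0)[/(divides_lform_lform a0)|/IHs[c cs]].
  by exists b; rewrite ?mem_head.
by exists c; rewrite // inE cs orbT.
Qed.

Lemma nonprop_split A a : {in A, forall b, b != 0} -> nonprop A -> a \in A ->
  exists s, [/\ defpoly A = lform a * defpoly s,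
    {in A, forall b, b = a \/ b \in s} & {in s, forall b, ~~ (b <= a)%MS}].
Proof.
move=> nzA npA aA; case/splitPr: aA nzA npA => s1 s2 nzA.
rewrite /nonprop pairwise_cat /= => /and3P[/allrelP np1 _ /andP[/allP np2 _]].
exists (s1 ++ s2); split.
- by rewrite /defpoly !big_cat big_cons /= mulrCA.
- move=> b; rewrite mem_cat inE => /or3P[bs|/eqP ->|bs]; [right|left|right] => //.
    by rewrite mem_cat bs.
  by rewrite mem_cat bs orbT.
- move=> b; rewrite mem_cat => /orP[bs|bs].
    by apply: np1; rewrite ?mem_head.
  have b0 : b != 0 by apply: nzA; rewrite mem_cat inE bs !orbT.
  by apply: contra (np2 b bs); apply: prop_sym.
Qed.

(** Each linear factor on the right is prime and does not divide [u], so it divides the cofactor and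
    can be cancelled, until only 1 remains. *)
Lemma coprime_divisor_unit A (u x : S) e : {in A, forall a, a != 0} ->
  {in A, forall a, ~ divides (lform a) u} -> u * x = defpoly A ^+ e ->
  exists w, u * w = 1.
Proof.
move=> nzA npu.
have strip s y z : {subset s <= A} -> u * y = defpoly s * z ->
    exists y', u * y' = z.
  elim: s y z => [|a s IHs] y z sub.
    by rewrite /defpoly big_nil mul1r; exists y.
  rewrite /defpoly big_cons -mulrA => eq_uy.
  have aA : a \in A by apply: sub; rewrite mem_head.
  have [|/(npu a aA)//|[y' def_y]] := @divides_lformM _ _ a u y (nzA a aA).
    by rewrite eq_uy mulrC; eexists.
  apply: (IHs y') => [b bs|]; first by apply: sub; rewrite inE bs orbT.
  apply: (@mulIf _ (lform a)); first by rewrite lform_eq0 nzA.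
  by rewrite -mulrA -def_y eq_uy mulrC.
elim: e x => [|e IHe] x; first by rewrite expr0; exists x.
by rewrite exprS => /(strip A)[//|y /IHe].
Qed.

Lemma logmx_defpoly A : logmx A ((defpoly A)%:M : 'M[S]_n).
Proof.
move=> a aA i; rewrite mul_scalar_mx mxE; apply: divides_mulr.
rewrite /defpoly (big_rem a) //= mulrC; exact: divides_mull (divides_refl _).
Qed.

Lemma generates_matrix A m (B : 'I_m -> Defs.deriv K n) : generates A B ->
  let V : 'M[S]_(m, n) := \matrix_(i, j) B i j in logmx A V /\
  forall v : 'rV[S]_n, logmx A v -> exists w : 'rV_m, v = w *m V.
Proof.
case=> hB genB V; split.
  apply: logmx_row => i; have /inD_logmx := hB i.
  by congr logmx; apply/rowP=> j; rewrite !mxE.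
move=> v hv; have /genB[c def_c] : inD A [ffun j => v 0 j].
  apply/inD_logmx; suff -> : \row_i [ffun j => v 0 j] i = v by [].
  by apply/rowP=> j; rewrite !mxE ffunE.
exists (\row_i c i); apply/rowP=> j.
have := congr1 (fun f : Defs.deriv K n => f j) def_c.
rewrite /= !ffunE => ->; rewrite mxE.
by apply: eq_bigr => i _; rewrite !mxE.
Qed.

Lemma free_arr_matrix A : free_arr A ->
  exists m (V : 'M[S]_(m, n)), [/\ logmx A V, lfree V
    & forall v : 'rV[S]_n, logmx A v -> exists w : 'rV_m, v = w *m V].
Proof.
case=> m [B [/generates_matrix[logV genV] freeB]].
exists m, (\matrix_(i, j) B i j); split=> // c cV0; apply/rowP=> j.
rewrite [RHS]mxE; apply: (freeB (fun i => c 0 i)); apply/ffunP=> k.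
rewrite !ffunE; have := congr1 (fun v : 'rV_n => v 0 k) cV0.
rewrite /= !mxE => eq0.
by apply: etrans eq0; apply: eq_bigr => i _; rewrite mxE.
Qed.

(** The converse of Saito's criterion. Comparison with [defpoly A] times the identity shows that a
    basis has n elements and that [u] divides a power of [defpoly A]. For each [a] in [A], a
    logarithmic matrix whose determinant contains [lform a] only once shows that [lform a] does not
    divide [u]. *)
Lemma free_arr_basis A : {in A, forall a, a != 0} -> nonprop A ->
  forall A', {subset A <= A'} ->
  {in A', forall a, exists2 b, b \in A & (a <= b)%MS} -> free_arr A' ->
  exists (V : 'M[S]_n) u w, [/\ logmx A V,
    forall p (W : 'M[S]_(p, n)), logmx A W -> exists Z, W = Z *m V,
    \det V = u * defpoly A & u * w = 1].
Proof.
move=> nzA npA A' sub cov /free_arr_matrix[m [V [logV freeV genV]]].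
have genm p (W : 'M[S]_(p, n)) : logmx A W -> exists Z, W = Z *m V.
  move=> logW; apply: rows_choice => i; apply: genV; rewrite rowE.
  exact/logmxM/(logmx_cover cov).
have [Z defZ] := genm _ _ (@logmx_defpoly A).
have freeZ : lfree Z.
  move=> c cZ0; have : c *m (defpoly A)%:M = 0 by rewrite defZ mulmxA cZ0 mul0mx.
  rewrite mul_mx_scalar -[RHS](scaler0 _ (defpoly A)).
  exact/scalemx_inj/defpoly_neq0.
have def_m : m = n by apply/anti_leq; rewrite (lfree_leq freeV) (lfree_leq freeZ).
subst m; move/(logmx_sub sub): logV => logV {freeV freeZ genV}.
have [u detV] := defpoly_divides_det nzA npA logV.
suff npu : {in A, forall a, ~ divides (lform a) u}.
  have [|w uw1] := @coprime_divisor_unit A u (\det Z * defpoly A) n nzA npu.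
    by rewrite mulrCA -detV -det_mulmx -defZ det_scalar.
  by exists V, u, w.
move=> a aA dvd_au; have a0 := nzA a aA.
have [s [defA splitA nps]] := nonprop_split nzA npA aA.
(* By the choice of [y], the matrix [1%:M + x *m y] has determinant [lform a] and multiplies [x] by
   [lform a]; so [W] is logarithmic with determinant [lform a * defpoly s ^+ n]. *)
pose x : 'cV[S]_n := cmx a^T.
pose y : 'rV[S]_n := (lform a - 1) *: cmx (pinvmx a)^T.
have yx : y *m x = (lform a - 1)%:M.
  rewrite -scalemxAl -map_mxM -trmx_mul mulmxVp ?row_neq0_free //.
  by rewrite trmx1 map_scalar_mx rmorph1 scalemx1.
pose W := defpoly s *: (1%:M + x *m y).
have logW : logmx A W.
  move=> b bA i; rewrite -scalemxAl mxE; case: (splitA b bA) => [->|bs].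
    rewrite mulmxDl mul1mx -mulmxA yx mul_mx_scalar scalerBl scale1r addrC subrK.
    by rewrite mxE; apply/divides_mull/divides_mulr/divides_refl.
  apply: divides_mulr; rewrite /defpoly (big_rem b) //=.
  exact/divides_mulr/divides_refl.
have [T defW] := genm _ _ logW.
have : divides (lform a * lform a) (lform a * defpoly s ^+ n).
  have -> : lform a * defpoly s ^+ n = \det T * (u * defpoly A).
    rewrite -detV -det_mulmx -defW detZ det_rank1_update yx mxE eqxx mulr1n.
    by rewrite addrC subrK mulrC.
  case: dvd_au => q ->; exists (\det T * q * defpoly s).
  by rewrite defA; ring.
case=> q /esym; rewrite mulrA -[_ * lform a]mulrC.
move/mulfI=> /(_ (etrans (f_equal negb (lform_eq0 a)) a0)) e_s.
have /(divides_lformX a0)[|/divides_lform1//] :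
    divides (lform a) (defpoly s ^+ n) by exists q.
by case/(divides_lform_prod a0) => b /nps/negP.
Qed.

End FreeBasis.

(** * Restriction to a hyperplane *)

Section Restriction.
Variables (K : fieldType) (k : nat).
Local Notation n := (1 + k)%N.
Local Notation S := {mpoly K[n]}.
Local Notation T := {mpoly K[k]}.
Variables (aH : 'rV[K]_n) (P : 'M[K]_(n, k)).
Hypotheses (aH_neq0 : aH != 0) (aHP : aH *m P = 0) (rankP : \rank P = k).

Local Notation res := (lsub P).
Local Notation R := (pinvmx P).

Lemma pinvP : R *m P = 1%:M.
Proof. by apply: mulVpmx; rewrite /row_full rankP. Qed.

Lemma ker_restr m (b : 'M[K]_(m, n)) : b *m P = 0 -> (b <= aH)%MS.
Proof.
move/sub_kermxP => le_b; apply: submx_trans le_b _.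
have le_aH : (aH <= kermx P)%MS by apply/sub_kermxP.
rewrite -(geq_leqif (mxrank_leqif_sup le_aH)) mxrank_ker rankP addnK.
by rewrite rank_rV aH_neq0.
Qed.

Lemma res_eq0 p : res p = 0 -> divides (lform aH) p.
Proof.
move=> resp; have /submxP[D defD] : ((1%:M - P *m R)%R <= aH)%MS.
  by apply: ker_restr; rewrite mulmxBl mul1mx -mulmxA pinvP mulmx1 subrr.
rewrite -[p]lsub1 -[X in divides _ X]subr0.
have <- : lsub (P *m R) p = 0 by rewrite -lsub_comp resp linear0.
by apply: (@lsub_congr _ _ _ _ _ D); rewrite -defD addrC subrK.
Qed.

Lemma res_lform_aH : res (lform aH) = 0.
Proof. by rewrite lsub_lform aHP lform0. Qed.

Lemma res_divides p : divides (lform aH) p -> res p = 0.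
Proof. by case=> q ->; rewrite rmorphM /= res_lform_aH mulr0. Qed.

Lemma res_lift p : res (lsub R p) = p.
Proof. by rewrite lsub_comp pinvP lsub1. Qed.

Lemma map_res_cmx m p (M : 'M[K]_(m, p)) : map_mx res (cmx M) = cmx M.
Proof. by apply/matrixP=> i j; rewrite !mxE lsubC. Qed.

(* Restriction of derivations to H in the coordinates of K^k, R being a left
   inverse of P. *)
Definition restr_der m (V : 'M[T]_(m, n)) : 'M[T]_(m, k) := V *m cmx R^T.

(** [V] kills [aH] on H, and [a] differs from [a *m P *m R] by a multiple of [aH]; so the restricted
    derivations take on [a *m P] the restrictions of their values on [a]. *)
Lemma logmx_restr A m (V : 'M[S]_(m, n)) : logmx A V ->
  map_mx res V *m cmx aH^T = 0 ->
  logmx [seq a *m P | a <- A] (restr_der (map_mx res V)).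
Proof.
move=> logV VaH b /mapP[a aA ->] i; rewrite /restr_der -mulmxA -map_mxM -trmx_mul.
have /sub_rVP[c def_c] : ((a - a *m P *m R)%R <= aH)%MS.
  by apply: ker_restr; rewrite mulmxBl -[X in _ - X]mulmxA pinvP mulmx1 subrr.
have -> : a *m P *m R = a - c *: aH by rewrite -def_c opprB addrC subrK.
rewrite linearB linearZ /= map_mxB map_mxZ mulmxBr -scalemxAr VaH scaler0 subr0.
have [q def_q] := logV a aA i; exists (res q).
by rewrite -lsub_lform -rmorphM -def_q -map_res_cmx -map_mxM mxE.
Qed.

(** * The fibres of the restriction map and Terao's polynomial *)

Section Multiplicity.
Variables (A : seq 'rV[K]_n) (R0 : seq 'rV[K]_k).
Hypotheses (nzA : {in A, forall a, a != 0}) (npA : nonprop A).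
Hypothesis notH : {in A, forall a, ~~ (a <= aH)%MS}.
Hypotheses (npR : nonprop R0) (subR : {subset R0 <= [seq a *m P | a <- A]}).
Hypothesis covR :
  {in [seq a *m P | a <- A], forall a, exists2 b, b \in R0 & (a <= b)%MS}.

Lemma restr_neq0 : {in A, forall a, a *m P != 0}.
Proof. by move=> a /notH; apply: contra => /eqP/ker_restr. Qed.

Lemma nzR : {in R0, forall b, b != 0}.
Proof. by move=> b /subR/mapP[a aA ->]; apply: restr_neq0. Qed.

Definition fibre (b : 'rV[K]_k) := [seq a <- A | (a *m P <= b)%MS].

Lemma res_defpoly_fibre b : exists2 c, c != 0 &
  res (defpoly (fibre b)) = c%:MP * lform b ^+ size (fibre b).
Proof.
have : {in fibre b, forall a, a *m P != 0 /\ (a *m P <= b)%MS}.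
  by move=> a; rewrite mem_filter => /andP[le_ab /restr_neq0].
rewrite /defpoly; elim: (fibre b) => [|a s IHs] hs.
  by exists 1; rewrite ?oner_eq0 // big_nil rmorph1 expr0 mulr1.
have [a' hs'|c c0 IH] := IHs; first by apply: hs; rewrite inE hs' orbT.
have [aP0 /sub_rVP[d def_d]] := hs a (mem_head _ _).
exists (d * c).
  rewrite mulf_neq0 //; apply: contra_neq aP0 => d0.
  by rewrite def_d d0 scale0r.
rewrite big_cons rmorphM /= IH lsub_lform def_d lformZ exprS mpolyCM.
by rewrite -mul_mpolyC mulrACA.
Qed.

Lemma defpoly_fibres : defpoly A = \prod_(b <- R0) defpoly (fibre b).
Proof.
rewrite /defpoly; under [RHS]eq_bigr do rewrite big_filter.
rewrite (exchange_big_dep xpredT) //=; apply: eq_big_seq => a aA.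
have [b bR le_b] := covR (map_f _ aA).
have nzb := nzR; move: npR nzb; case/splitPr: bR => s1 s2.
rewrite /nonprop pairwise_cat /= => /and3P[/allrelP np1 _ /andP[/allP np2 _]] nzb.
rewrite big_cat big_cons /= le_b !big1_seq ?mul1r ?mulr1 //.
  move=> b' /andP[le_b' bs]; have := np2 _ bs; case/negP.
  exact: submx_trans (prop_sym (restr_neq0 aA) le_b) le_b'.
move=> b' /andP[le_b' bs]; have := np1 _ _ bs (mem_head _ _); case/negP.
exact: submx_trans (prop_sym (restr_neq0 aA) le_b') le_b.
Qed.

Definition terao_poly : T := \prod_(b <- R0) lform b ^+ (size (fibre b)).-1.

Lemma size_fibre b : b \in R0 -> exists2 a, a \in A & a *m P = b.
Proof. by move=> /subR/mapP[a aA ->]; exists a. Qed.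

Lemma fibre_gt0 b : b \in R0 -> (0 < size (fibre b))%N.
Proof.
case/size_fibre=> a aA <-; rewrite size_filter -has_count.
by apply/hasP; exists a.
Qed.

Lemma res_defpoly : exists2 c, c != 0 &
  res (defpoly A) = c%:MP * (defpoly R0 * terao_poly).
Proof.
rewrite defpoly_fibres rmorph_prod /= /defpoly /terao_poly -big_split /=.
have : {in R0, forall b, (0 < size (fibre b))%N} by apply: fibre_gt0.
elim: (R0) => [|b s IHs] hs.
  by exists 1; rewrite ?oner_eq0 // !big_nil mulr1.
have [b' bs|c c0 IH] := IHs; first by apply: hs; rewrite inE bs orbT.
have [d d0 def_d] := res_defpoly_fibre b; exists (d * c).
  by rewrite mulf_neq0.
rewrite !big_cons IH [res _]def_d mpolyCM mulrACA; congr (_ * (_ * _)).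
by rewrite -exprS prednK // hs // mem_head.
Qed.

(* For L = ker a in the fibre of H n L, the polynomial b th(aH) - aH th(b) is
   divisible by a, as a is a combination of b and aH. *)
Lemma terao_poly_divides (v : 'rV[S]_n) : logmx A v ->
  divides terao_poly (res ((v *m cmx aH^T) 0 0)).
Proof.
move=> logv; apply: prod_lform_pow_divides => //; first exact: nzR.
move=> b bR; have [a0 a0A def_b] := size_fibre bR.
pose th (a : 'rV[K]_n) : S := (v *m cmx a^T) 0 0.
pose p := lform a0 * th aH - lform aH * th a0.
have [q def_p] : divides (defpoly (fibre b)) p.
  apply: prod_lform_divides => [a||a].
  - by rewrite mem_filter => /andP[_ /nzA].
  - exact: subseq_pairwise (filter_subseq _ _) npA.
  rewrite mem_filter => /andP[/sub_rVP[c def_c] aA].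
  have c0 : c != 0.
    by apply: contra_neq (restr_neq0 aA) => c0; rewrite def_c c0 scale0r.
  have /sub_rVP[d def_d] : ((a - c *: a0)%R <= aH)%MS.
    by apply: ker_restr; rewrite mulmxBl -scalemxAl def_b def_c subrr.
  have def_a : a = c *: a0 + d *: aH by rewrite -def_d addrC subrK.
  have [q def_q] := logv a aA 0.
  have la : lform a = c%:MP * lform a0 + d%:MP * lform aH.
    by rewrite def_a lformD !lformZ !mul_mpolyC.
  have tha : q * lform a = c%:MP * th a0 + d%:MP * th aH.
    rewrite -def_q {1}def_a linearD /= ![(_ *: _)^T]linearZ /= map_mxD.
    rewrite !map_mxZ mulmxDr.
    by rewrite -!scalemxAr mxE [X in X + _]mxE [X in _ + X]mxE.
  (* Eliminating [lform a0] and [th a0] by means of [def_a] and [def_q] gives c p = (th aH - q lform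
     aH) lform a. *)
  exists (c^-1%:MP * (th aH - q * lform aH)).
  have cV : c^-1%:MP * c%:MP = 1 :> S by rewrite -mpolyCM mulVf // mpolyC1.
  transitivity (c^-1%:MP * c%:MP * p); first by rewrite cV mul1r.
  rewrite /p -!mulrA; congr (_ * _).
  rewrite mulrBl -[q * _ * _]mulrA [lform aH * lform a]mulrC mulrA tha la; ring.
have [c c0 res_f] := res_defpoly_fibre b.
(* The other term of [p] vanishes on H. The factor [lform b] left here is cancelled at the end,
   whence the exponent [(size (fibre b)).-1] in [terao_poly]. *)
have : res p = lform b * res (th aH).
  by rewrite /p rmorphB !rmorphM /= res_lform_aH mul0r subr0 lsub_lform def_b.
rewrite def_p rmorphM /= res_f -[size _]prednK ?fibre_gt0 // exprS => eq_b.
exists (res q * c%:MP); apply: (@mulfI _ (lform b)).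
  by rewrite lform_eq0 nzR.
by rewrite -eq_b; ring.
Qed.

End Multiplicity.
End Restriction.

(** * Syzygies near the origin *)

Lemma ev_cmx (K : fieldType) d m n (M : 'M[K]_(m, n)) :
  ev (cmx M : 'M[{mpoly K[d]}]_(m, n)) = M.
Proof. by apply/matrixP=> i j; rewrite !mxE mcoeffC eqxx mulr1. Qed.

Lemma det_ev (K : fieldType) d m (M : 'M[{mpoly K[d]}]_m) :
  (\det M)@0 = \det (ev M).
Proof. by rewrite det_map_mx. Qed.

Lemma row_free_extend (F : fieldType) m n (M : 'M[F]_(m, n)) :
  (m < n)%N -> row_free M -> exists y : 'rV_n, row_free (col_mx y M).
Proof.
move=> lt_mn freeM.
have [i nle_i] : exists i, ~~ (row i 1%:M <= M)%MS.
  apply/existsP; apply: contraLR lt_mn; rewrite negb_exists -leqNgt.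
  move=> /forallP le_M; have /mxrankS : (1%:M <= M)%MS.
    by apply/row_subP=> i; have := le_M i; rewrite negbK.
  by rewrite mxrank1 (eqP freeM).
exists (row i 1%:M); rewrite /row_free eqn_leq rank_leq_row.
suff : (\rank M < \rank (col_mx (row i 1%:M) M))%N by rewrite (eqP freeM).
rewrite -addsmxE; apply: rank_ltmx.
by rewrite ltmxE addsmxSr /=; apply: contra nle_i; exact/submx_trans/addsmxSl.
Qed.

Lemma row_free_col_mxCA (F : fieldType) m1 m2 m3 n (A : 'M[F]_(m1, n))
    (B : 'M_(m2, n)) (C : 'M_(m3, n)) :
  row_free (col_mx A (col_mx B C)) -> row_free (col_mx B (col_mx A C)).
Proof.
have E m4 m5 m6 (X : 'M[F]_(m4, n)) (Y : 'M_(m5, n)) (Z : 'M_(m6, n)) :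
    \rank (col_mx X (col_mx Y Z)) = \rank (X + (Y + Z))%MS.
  by rewrite -addsmxE (adds_eqmx (eqmx_refl X) (addsmxE Y Z)).
rewrite /row_free !E !addsmxA [(B + A)%MS]addsmxC => /eqP ->.
by rewrite addnCA.
Qed.

Section LocalSyzygies.
Variables (K : fieldType) (k : nat).
Local Notation T := {mpoly K[k]}.
Local Notation n := (1 + k)%N.
Variables (f : 'cV[T]_n) (kap kap' : T).
Hypotheses (f_neq0 : f != 0) (kapK : kap * kap' = 1).

(* By the Hilbert-Burch relation, the maximal minors of the syzygy matrix F are
   the entries of f up to the factor h and a unit. *)
Definition hilbert_burch (F : 'M[T]_(k, n)) h :=
  forall y : 'rV_n, kap * \det (col_mx y F) = h * (y *m f) 0 0.

(** [h] is quantified because it is found only later, as the quotient of a determinant by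
    [defpoly R0]; as [f] is nonzero, at most one [h] satisfies the relation. *)
Definition locally_saturated (F : 'M[T]_(k, n)) :=
  F *m f = 0 /\ forall h, hilbert_burch F h -> h@0 != 0.

Lemma kap0 : kap@0 != 0.
Proof.
apply: contra_eq_neq kapK => kap0; apply/negP=> /eqP/(congr1 (mcoeff 0%MM)).
by rewrite rmorphM /= kap0 mul0r rmorph1 => /esym/eqP; rewrite oner_eq0.
Qed.

(** As [F *m f = 0], the product of [col_mx y F] and [row_mx f X] is block triangular, with
    determinant (y f) det (F X). If [y] picks a nonzero entry of [f], this entry cancels. *)
Lemma hilbert_burch_minor F h (X : 'M_(n, k)) : F *m f = 0 ->
  hilbert_burch F h -> kap * \det (F *m X) = h * \det (row_mx f X).
Proof.
move=> Ff hF; have /matrix0Pn[j [i]] := f_neq0; rewrite ord1 => fj0.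
pose y : 'rV[T]_n := delta_mx 0 j.
have yf : (y *m f) 0 0 = f j 0 by rewrite -rowE mxE.
have := congr1 determinant (mul_col_row y F f X).
rewrite det_mulmx Ff det_ublock det_mx11 yf => eq_d.
apply: (mulfI fj0); rewrite mulrCA -eq_d mulrA hF yf; ring.
Qed.

End LocalSyzygies.

(** * Rank of C(0) at least l - 2: completion by a Koszul relation *)

Section TwoGenerators.
Variables (K : fieldType) (e : nat).
Local Notation k := (1 + e)%N.
Local Notation T := {mpoly K[k]}.
Local Notation n := (1 + k)%N.
Variables (f : 'cV[T]_n) (kap kap' : T).
Hypotheses (f_neq0 : f != 0) (kapK : kap * kap' = 1).
Variable F1 : 'M[T]_(e, n).
Hypotheses (F1f : F1 *m f = 0) (freeF1 : row_free (ev F1)).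

(* The last syzygy is the Koszul relation between the two remaining entries
   y1 f and y2 f. *)
Lemma saturated_koszul : exists F, locally_saturated f kap F.
Proof.
have [|y2 free2] := row_free_extend _ freeF1; first by lia.
have [|y1 free1] := row_free_extend _ free2; first by lia.
(* The rows [y1], [y2] and [F1] form a matrix invertible at the origin, so they cannot all kill [f];
   after a swap [y1] does not. *)
wlog y1f : y1 y2 free1 {free2} / (cmx y1 *m f) 0 0 != 0.
  move=> IH; have [y1f|] := eqVneq ((cmx y1 *m f) 0 0) 0; last exact: IH free1.
  apply: (IH y2 y1); first exact: row_free_col_mxCA free1.
  apply: contra_neq f_neq0 => y2f.
  pose G : 'M[T]_n := col_mx (cmx y1) (col_mx (cmx y2) F1).
  have G0 : \det G != 0.
    apply/negP=> /eqP/(congr1 (mcoeff 0%MM)); rewrite det_ev !map_col_mx.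
    rewrite !ev_cmx raddf0 => /eqP; apply/negP; rewrite -unitfE -unitmxE.
    by rewrite -row_free_unit.
  have Gf : G *m f = 0.
    rewrite !mul_col_mx F1f [cmx y1 *m f]mx11_scalar [cmx y2 *m f]mx11_scalar.
    by rewrite y1f y2f !raddf0 !col_mx0.
  apply: (scalemx_inj G0); rewrite -mul_scalar_mx -mul_adj_mx -mulmxA Gf.
  by rewrite mulmx0 scaler0.
set a := (cmx y1 *m f) 0 0 in y1f; pose b := (cmx y2 *m f) 0 0.
pose w : 'rV[T]_n := a *: cmx y2 - b *: cmx y1.
have wf : w *m f = 0.
  rewrite mulmxBl -!scalemxAl [cmx y1 *m f]mx11_scalar [cmx y2 *m f]mx11_scalar.
  by rewrite -/a -/b -!mul_scalar_mx -!scalar_mxM mulrC subrr.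
exists (col_mx w F1); split; first by rewrite mul_col_mx wf F1f col_mx0.
move=> h /(_ (cmx y1)); rewrite -/a.
pose G : 'M[T]_n := col_mx (cmx y1) (col_mx (cmx y2) F1).
(* Up to a multiple of the row [y1], [w] is [a] times [y2]. Cancelling [a] in the relation for [y1]
   leaves h = kap det G, which is nonzero at the origin. *)
have -> : \det (col_mx (cmx y1) (col_mx w F1) : 'M_n) = a * \det G.
  pose M : 'M[T]_n := block_mx 1%:M 0 (col_mx (- b)%:M 0)
    (block_mx a%:M 0 0 1%:M).
  have -> : col_mx (cmx y1) (col_mx w F1) = M *m G.
    rewrite mul_block_col mul1mx mul0mx addr0 mul_block_col mul1mx !mul0mx.
    rewrite mul_col_mx mul0mx addr0 add_col_mx !add0r !mul_scalar_mx.
    by rewrite scaleNr addrC.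
  by rewrite det_mulmx !det_lblock !det1 det_mx11 mxE eqxx mul1r mulr1.
rewrite mulrCA [RHS]mulrC => /(mulfI y1f) <-.
rewrite rmorphM mulf_neq0 ?(kap0 kapK) //= det_ev !map_col_mx !ev_cmx.
by rewrite -unitfE -unitmxE -row_free_unit.
Qed.

End TwoGenerators.

(** * Rank of E(0) at least 3: elimination of three generators *)

Section ThreeRelations.
Variables (K : fieldType) (k : nat).
Local Notation T := {mpoly K[k]}.
Local Notation n := (1 + k)%N.
Variables (f : 'cV[T]_n) (kap kap' : T).
Hypotheses (f_neq0 : f != 0) (kapK : kap * kap' = 1).
Variables (m : nat) (C : 'M[T]_(m, n)) (E : 'M[T]_(n, m)).
Hypotheses (Cf : C *m f = 0) (EC : E *m C = 0).
Hypothesis genC : forall v : 'rV_n, v *m f = 0 -> exists z : 'rV_m, v = z *m C.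
Hypotheses (rankE : (3 <= \rank (ev E))%N) (le_m : (m <= k + 3)%N).

(* Three independent relations at the origin make three of the generators
   superfluous near the origin, i.e. after multiplication by d. *)
Lemma local_generators : exists (F : 'M[T]_(k, n)) (d : T),
  [/\ d@0 != 0, F *m f = 0 &
    forall v : 'rV_n, v *m f = 0 -> exists z : 'rV_k, d *: v = z *m F].
Proof.
have [m' def_m] : exists m', m = (3 + m')%N.
  by exists (m - 3)%N; have := rank_leq_col (ev E); lia.
move: C E Cf EC genC rankE le_m; rewrite def_m => C0 E0 C0f EC0 genC0 rE0 le_m'.
(* In the bases of the rank normal form of E(0), three combinations of the relations become the
   first three unit vectors at the origin. *)
pose L := invmx (col_ebase (ev E0)); pose U := row_ebase (ev E0).
have uU : U \in unitmx by apply: row_ebase_unit.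
pose Z : 'M[K]_(3, n) := pid_mx 3 *m L.
pose P1 : 'M[T]_(3, 3 + m') := cmx Z *m E0 *m cmx (invmx U).
pose C1 : 'M[T]_(3 + m', n) := cmx U *m C0.
have UK : cmx (invmx U) *m cmx U = 1%:M :> 'M[T]__.
  by rewrite -map_mxM mulVmx // map_scalar_mx rmorph1.
have PC1 : P1 *m C1 = 0.
  rewrite /P1 /C1 mulmxA -[_ *m cmx _ *m cmx _]mulmxA UK mulmx1 -mulmxA EC0.
  by rewrite mulmx0.
have evP1 : ev P1 = row_mx 1%:M 0.
  rewrite !map_mxM !ev_cmx /Z -{1}(mulmx_ebase (ev E0)) -/U.
  rewrite !mulmxA mulmxKV ?col_ebase_unit // mulmxK //.
  rewrite mul_pid_mx -pid_mx_row; congr pid_mx.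
  by have := rank_leq_row (ev E0); lia.
pose Pa := lsubmx P1; pose Pb := rsubmx P1; pose d := \det Pa.
pose Cb := dsubmx C1.
have dCa : d *: usubmx C1 = - (\adj Pa *m Pb) *m Cb.
  have : Pa *m usubmx C1 + Pb *m Cb = 0.
    by rewrite -mul_row_col hsubmxK vsubmxK.
  move/(congr1 (mulmx (\adj Pa))); rewrite mulmxDr !mulmxA mul_adj_mx mulmx0.
  by rewrite mul_scalar_mx mulNmx => /eqP; rewrite addr_eq0 => /eqP.
have Cbf : Cb *m f = 0.
  have : C1 *m f = 0 by rewrite -mulmxA C0f mulmx0.
  rewrite -[C1]vsubmxK mul_col_mx => /(congr1 dsubmx).
  by rewrite col_mxKd linear0.
(* Since m' <= k, [pid_mx m'] pads [Cb] with zero rows to exactly k rows. *)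
pose F : 'M[T]_(k, n) := pid_mx m' *m Cb.
have def_Cb : Cb = (pid_mx m' : 'M_(m', k)) *m F.
  rewrite mulmxA mul_pid_mx (_ : minn _ _ = m'); last by lia.
  by rewrite pid_mx_1 mul1mx.
exists F, d; split.
- rewrite /d det_ev; have -> : ev Pa = 1%:M.
    by rewrite map_lsubmx evP1 row_mxKl.
  by rewrite det1 oner_eq0.
- by rewrite -mulmxA Cbf mulmx0.
move=> v /genC0[z def_v]; pose z1 := z *m cmx (invmx U).
have def_v1 : v = lsubmx z1 *m usubmx C1 + rsubmx z1 *m Cb.
  rewrite -mul_row_col hsubmxK vsubmxK mulmxA -[_ *m _ *m cmx U]mulmxA.
  by rewrite UK mulmx1.
exists ((d *: rsubmx z1 - lsubmx z1 *m (\adj Pa *m Pb)) *m pid_mx m').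
rewrite -mulmxA -def_Cb def_v1 scalerDr scalemxAr dCa mulmxBl scalemxAl addrC.
by rewrite mulNmx mulmxN !mulmxA.
Qed.

(** If [h] divides [c *m F], the quotient is a syzygy, so [d] times it is some [z *m F], and
    independence of the rows gives [d *: c = h *: z]. As [h] also divides the maximal minors of [F],
    McCoy's theorem makes it divide a power of [d], which does not vanish at the origin. *)
Lemma saturated_generators : exists F, locally_saturated f kap F.
Proof.
have [F [d [d0 Ff genF]]] := local_generators.
exists F; split=> // h hF.
have hbX X := hilbert_burch_minor f_neq0 X Ff hF.
have /matrix0Pn[j [i]] := f_neq0; rewrite ord1 => fj0 {i}.
pose X : 'M[T]_(n, k) := \matrix_(i, j') (i == lift j j')%:R.
have detFX : \det (F *m X) != 0.
  pose y : 'rV[T]_n := delta_mx 0 j.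
  (* The rows of [Y] are the Koszul relations between entry [j] of [f] and the other entries, and
     [X] deletes coordinate [j]. Since [d *: Y] factors through [F], the determinant of [F *m X]
     divides a nonzero element. *)
  pose Y := f j 0 *: X^T - (X^T *m f) *m y.
  have yf : y *m f = (f j 0)%:M by rewrite [LHS]mx11_scalar -rowE mxE.
  have yX : y *m X = 0.
    apply/rowP=> j'; rewrite -rowE !mxE.
    by rewrite (negPf (neq_lift _ _)).
  have XX : X^T *m X = 1%:M.
    apply/matrixP=> a b; rewrite !mxE (bigD1 (lift j a)) //= !mxE eqxx mul1r.
    rewrite (inj_eq (@lift_inj _ j)) big1 ?addr0 // => c ne_c.
    by rewrite !mxE (negPf ne_c) mul0r.
  have Yf : Y *m f = 0.
    by rewrite mulmxBl -[_ *m y *m f]mulmxA yf mul_mx_scalar -scalemxAl subrr.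
  have YX : Y *m X = (f j 0)%:M.
    rewrite mulmxBl -[_ *m y *m X]mulmxA yX mulmx0 subr0 -scalemxAl XX.
    by rewrite scalemx1.
  have [|Z dY] := @rows_choice _ _ _ _ (d *: Y) F.
    move=> i; rewrite linearZ /=; apply: genF.
    by rewrite -row_mul Yf linear0.
  have : \det (d *: Y *m X) != 0.
    rewrite -scalemxAl YX scale_scalar_mx det_scalar expf_neq0 // mulf_neq0 //.
    by apply: contra_neq d0 => ->; rewrite mcoeff0.
  by rewrite dY -mulmxA det_mulmx mulf_eq0 negb_or => /andP[].
have h0 : h != 0.
  apply: contra_neq detFX => h0; have := hbX X; rewrite h0 mul0r => /eqP.
  rewrite mulf_eq0 => /orP[/eqP kap_0|/eqP//].
  by have := oner_neq0 T; rewrite -kapK kap_0 mul0r eqxx.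
have freeF : lfree F.
  move=> c cF; apply: (lfree_det detFX); by rewrite mulmxA cF mul0mx.
have [c dvd_cF|g|e [q def_q]] := @mccoy _ _ _ F h d.
- have [w def_w] := divides_choice dvd_cF; pose W := \row_j w j.
  have def_cF : c *m F = h *: W.
    by apply/rowP=> l; rewrite def_w !mxE mulrC.
  have Wf : W *m f = 0.
    apply: (scalemx_inj h0); rewrite scalemxAl -def_cF -mulmxA Ff mulmx0.
    by rewrite scaler0.
  have [z dW] := genF W Wf => l.
  have /freeF/rowP/(_ l) : (d *: c - h *: z) *m F = 0.
    by rewrite mulmxBl -!scalemxAl def_cF -dW !scalerA mulrC subrr.
  rewrite !mxE => /eqP; rewrite subr_eq0 => /eqP->.
  by apply/divides_mulr/divides_refl.
- have -> : colsub g F = F *m colsub g 1%:M by rewrite mulmx_colsub mulmx1.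
  have := hbX (colsub g 1%:M) => /(congr1 ( *%R kap')).
  rewrite mulrA [kap' * kap]mulrC kapK mul1r => ->.
  exact/divides_mull/divides_mulr/divides_refl.
apply: contra_neq (expf_neq0 e d0) => h_0.
by rewrite -rmorphXn def_q rmorphM /= h_0 mulr0.
Qed.

End ThreeRelations.

(** * Freeness of the restriction *)

(** By the product rule, the derivative of [E *m C] at the origin in a variable occurring in [a] is
    a sum of two matrices, one factoring through [ev C] and one through [ev E]; it is also an
    invertible scalar matrix. *)
Lemma rank_linear_multiple (K : fieldType) n m (a : 'rV[K]_n)
    (E : 'M[{mpoly K[n]}]_(n, m)) C : a != 0 -> E *m C = (lform a)%:M ->
  (n <= \rank (ev C) + \rank (ev E))%N.
Proof.
move=> /rV0Pn[i ai0] EC; pose D (p : {mpoly K[n]}) := (p^`M(i))@0.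
have D_EC : map_mx D (E *m C) = map_mx D E *m ev C + ev E *m map_mx D C.
  apply/matrixP=> x y; rewrite !mxE /D (raddf_sum (mderiv i)) raddf_sum.
  rewrite -big_split /=; apply: eq_bigr => z _; rewrite !mxE /= mderivM mcoeffD.
  by rewrite !rmorphM.
have D_a : map_mx D (lform a)%:M = (a 0 i)%:M :> 'M_n.
  apply/matrixP=> x y; rewrite !mxE /D; case: eqP => _; last first.
    by rewrite !mulr0n mderiv0 mcoeff0.
  by rewrite !mulr1n mcoeff_deriv mnm0E mulr1n add0m lform_coeff.
have : \rank ((a 0 i)%:M : 'M[K]_n) = n.
  by apply/eqP; rewrite -/(row_free _) row_free_unit unitmxE det_scalar unitfE
    expf_neq0.
rewrite -D_a -EC D_EC => {1}<-; apply: leq_trans (mxrank_add _ _) _.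
by apply: leq_add; [apply: mxrankM_maxr|apply: mxrankM_maxl].
Qed.

Lemma row_free_pick (F : fieldType) m n r (M : 'M[F]_(m, n)) :
  (r <= \rank M)%N -> exists Z : 'M_(r, m), row_free (Z *m M).
Proof.
move=> le_r; exists (pid_mx r *m invmx (col_ebase M)).
rewrite -{2}(mulmx_ebase M) !mulmxA mulmxKV ?col_ebase_unit // mul_pid_mx.
have -> : minn m (minn r (\rank M)) = r.
  by have := rank_leq_row M; lia.
rewrite /row_free mxrankMfree ?row_free_unit ?row_ebase_unit //.
by rewrite rank_pid_mx // (leq_trans le_r (rank_leq_col M)).
Qed.

Section RestrictionBasis.
Variables (K : fieldType) (k : nat).
Local Notation n := (1 + k)%N.
Local Notation S := {mpoly K[n]}.
Local Notation T := {mpoly K[k]}.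
Variables (aH : 'rV[K]_n) (P : 'M[K]_(n, k)).
Hypotheses (aH_neq0 : aH != 0) (aHP : aH *m P = 0) (rankP : \rank P = k).
Variables (A : seq 'rV[K]_n) (R0 : seq 'rV[K]_k).
Hypotheses (nzA : {in A, forall a, a != 0}) (npA : nonprop A).
Hypothesis notH : {in A, forall a, ~~ (a <= aH)%MS}.
Hypotheses (npR : nonprop R0) (subR : {subset R0 <= [seq a *m P | a <- A]}).
Hypothesis covR :
  {in [seq a *m P | a <- A], forall a, exists2 b, b \in R0 & (a <= b)%MS}.
Variables (V : 'M[S]_n) (u w : S).
Hypotheses (logV : logmx A V) (detV : \det V = u * defpoly A) (uw1 : u * w = 1).

Local Notation res := (lsub P).
Local Notation R := (pinvmx P).
Local Notation Vr := (map_mx res V).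

Lemma det_coordinates : \det (row_mx aH^T R^T : 'M_n) != 0.
Proof.
pose G : 'M[K]_n := col_mx aH R.
have -> : (row_mx aH^T R^T : 'M_n) = G^T by rewrite tr_col_mx.
rewrite det_tr; have := congr1 determinant (mul_col_row aH R (pinvmx aH) P).
rewrite det_mulmx aHP (pinvP rankP) det_lblock mulmxVp ?row_neq0_free // !det1.
rewrite mulr1 => eq1; apply: contra_eq_neq eq1 => ->.
by rewrite mul0r eq_sym oner_neq0.
Qed.

(** In the coordinates [aH], [R] the product of [col_mx y F] with [Vr] is block upper triangular;
    its diagonal blocks are Terao's polynomial times y f and the derivations induced on H. Taking
    determinants and cancelling [defpoly R0] times Terao's polynomial, which is det Vr up to a unit,
    gives the Hilbert-Burch relation. *)
Lemma res_syzygy : exists (f : 'cV[T]_n) (kap kap' : T), [/\ f != 0,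
  kap * kap' = 1, Vr *m cmx aH^T = terao_poly P A R0 *: f
  & forall F : 'M[T]_(k, n), F *m f = 0 ->
    forall h, \det (restr_der P (F *m Vr)) = h * defpoly R0 ->
    hilbert_burch f kap F h].
Proof.
set B := terao_poly P A R0.
have [c c0 resQ] := res_defpoly aH_neq0 aHP rankP notH npR subR covR.
have [f0 def_f0] : exists f0, forall i, (Vr *m cmx aH^T) i 0 = f0 i * B.
  apply: divides_choice => i.
  have -> : (Vr *m cmx aH^T) i 0 = res ((row i V *m cmx aH^T) 0 0).
    rewrite -(map_res_cmx P) -map_mxM mxE; congr (res _).
    by rewrite -row_mul [RHS]mxE.
  apply: terao_poly_divides; rewrite // rowE; exact: logmxM.
pose f : 'cV[T]_n := \col_i f0 i.
have def_f : Vr *m cmx aH^T = B *: f.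
  by apply/colP=> i; rewrite def_f0 !mxE mulrC.
pose g := \det (row_mx aH^T R^T : 'M_n); have g0 : g != 0 := det_coordinates.
have B0 : B != 0.
  rewrite /B /terao_poly prodf_seq_neq0; apply/allP=> b bR /=.
  by rewrite expf_neq0 // lform_eq0 (nzR aH_neq0 aHP rankP notH subR).
have Q0 : defpoly R0 != 0.
  exact/defpoly_neq0/(nzR aH_neq0 aHP rankP notH subR).
pose kap := res u * c%:MP * g%:MP; pose kap' := res w * c^-1%:MP * g^-1%:MP.
have kapK : kap * kap' = 1.
  have -> : kap * kap' = res (u * w) * (c * c^-1)%:MP * (g * g^-1)%:MP.
    by rewrite /kap /kap' rmorphM /= !mpolyCM; ring.
  by rewrite uw1 !mulfV // rmorph1 !mpolyC1 !mulr1.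
have detVr : \det Vr * g%:MP = kap * (defpoly R0 * B).
  by rewrite det_map_mx detV rmorphM /= resQ /kap -/B; ring.
have relF (F : 'M[T]_(k, n)) (y : 'rV_n) : F *m f = 0 ->
    \det (col_mx y F) * (\det Vr * g%:MP)
      = B * (y *m f) 0 0 * \det (restr_der P (F *m Vr)).
  move=> Ff; have gC : g%:MP = \det (row_mx (cmx aH^T) (cmx R^T) : 'M[T]_n).
    by rewrite -map_row_mx det_map_mx.
  rewrite gC -!det_mulmx mul_mx_row def_f mul_col_row.
  rewrite -!scalemxAr Ff scaler0 det_ublock det_mx11 mxE.
  by rewrite /restr_der mulmxA.
exists f, kap, kap'; split=> //.
  apply/eqP=> f_0; pose y : 'rV[T]_n := usubmx 1%:M.
  pose F : 'M[T]_(k, n) := dsubmx 1%:M.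
  have := @relF F y; rewrite f_0 !mulmx0 => /(_ erefl).
  rewrite [X in _ * X * _]mxE mulr0 mul0r => /eqP.
  have -> : col_mx y F = 1%:M by rewrite /y /F vsubmxK.
  rewrite det1 mul1r detVr mulf_eq0 (negPf (mulf_neq0 Q0 B0)) orbF => /eqP kap0.
  by have := oner_neq0 T; rewrite -kapK kap0 mul0r eqxx.
move=> F Ff h det_h y.
have := relF F y Ff; rewrite detVr det_h => eq_h.
apply: (mulIf (mulf_neq0 Q0 B0)); rewrite mulrAC.
transitivity (\det (col_mx y F) * (kap * (defpoly R0 * B))); first by ring.
by rewrite eq_h; ring.
Qed.

(** [F] lifts to S through [R], so its rows induce logarithmic derivations on H. The quotient of
    their determinant by [defpoly R0] is the [h] of the saturation, and [saito_local] applies. *)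
Lemma restriction_basis (f : 'cV[T]_n) kap (F : 'M[T]_(k, n)) :
  Vr *m cmx aH^T = terao_poly P A R0 *: f ->
  (forall h, \det (restr_der P (F *m Vr)) = h * defpoly R0 ->
    hilbert_burch f kap F h) ->
  locally_saturated f kap F ->
  exists W c, [/\ logmx R0 W, c != 0 & \det W = c%:MP * defpoly R0].
Proof.
move=> def_f relF [Ff satF].
have nzR0 := nzR aH_neq0 aHP rankP notH subR.
pose W := restr_der P (F *m Vr).
have logW : logmx R0 W.
  apply: (logmx_sub subR); pose F' := map_mx (lsub R) F.
  have defF : F = map_mx res F'.
    by apply/matrixP=> i j; rewrite !mxE (res_lift rankP).
  rewrite /W defF -map_mxM; apply: (logmx_restr aH_neq0 aHP rankP).
    exact: logmxM.
  by rewrite map_mxM -mulmxA def_f -defF -scalemxAr Ff scaler0.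
have [h det_h] := defpoly_divides_det nzR0 npR logW.
exact: saito_local nzR0 npR logW det_h (satF h (relF h det_h)).
Qed.

End RestrictionBasis.

Theorem theorem3p7 (K : fieldType) (l : nat) (A : seq 'rV[K]_l)
  (aH : 'rV[K]_l) (P : 'M[K]_(l, l.-1)) :
  (3 <= l)%N ->
  central_arrangement A ->
  aH \in A ->
  (aH *m P = 0)%R -> \rank P = l.-1 ->
  free_arr (deletion A aH) ->
  g_le A l.+2 ->
  free_arr (restriction A aH P).
Proof.
case: l A aH P => [|[|e]] // A aH P _ nzA aHA aHP rankP freeA'.
case=> m [B [[_ [genB _]] le_m]].
pose k := (1 + e)%N; pose n := (1 + k)%N.
change ('rV[K]_n) in aH; change ('M[K]_(n, k)) in P.
change (\rank P = k) in rankP.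
change (seq 'rV[K]_n) in A; change ('I_m -> Defs.deriv K n) in B.
have aH0 : aH != 0 := nzA _ aHA.
have [A0 [npA0 subA0 covA0]] := exists_nonprop (deletion A aH).
have in_del a : a \in deletion A aH -> a \in A /\ ~~ (a <= aH)%MS.
  by rewrite mem_filter => /andP[].
have nzA0 : {in A0, forall a, a != 0} by move=> a /subA0/in_del[/nzA].
have notH : {in A0, forall a, ~~ (a <= aH)%MS} by move=> a /subA0/in_del[].
have [R0 [npR subR covR]] := exists_nonprop [seq a *m P | a <- A0].
have [V [u [w [logV genV detV uw1]]]] :=
  free_arr_basis nzA0 npA0 subA0 covA0 freeA'.
have [f [kap [kap' [f0 kapK def_f relF]]]] :=
  res_syzygy aH0 aHP rankP nzA0 npA0 notH npR subR covR logV detV uw1.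
suff [F satF] : exists F, locally_saturated f kap F.
  have [W [c [logW c0 detW]]] := restriction_basis aH0 aHP rankP notH npR subR
    logV def_f (relF F (proj1 satF)) satF.
  apply: (saito_free _ npR _ _ logW c0 detW).
  - exact: (nzR aH0 aHP rankP notH subR).
  - move=> b /subR/mapP[a /subA0 aA ->]; exact: map_f.
  - move=> b /mapP[a /covA0[a' a'A le_a] ->].
    have [b' b'R le_b] := covR _ (map_f _ a'A).
    by exists b' => //; apply: submx_trans le_b; apply: submxMr.
have logA p (W : 'M_(p, n)) : logmx A0 W ->
    (forall i, divides (lform aH) ((W *m cmx aH^T) i 0)) -> logmx A W.
  move=> logW divW; apply: (@logmx_cover _ _ _ (aH :: A0)).
    move=> a aA; have [le_a|nle_a] := boolP (a <= aH)%MS.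
      by exists aH; rewrite ?mem_head.
    have [|b bA0 le_ab] := covA0 a; first by rewrite mem_filter nle_a.
    by exists b; rewrite // inE bA0 orbT.
  by move=> a; rewrite inE => /predU1P[->|/logW].
have [] := generates_matrix genB; set G := \matrix_(i, j) _ => logG genG.
have sub_A0A : {subset A0 <= A} by move=> a /subA0/in_del[].
have [C defG] := genV _ G (logmx_sub sub_A0A logG).
have lfreeV : lfree V.
  apply: lfree_det; rewrite detV mulf_neq0 ?defpoly_neq0 //.
  by apply: contra_eq_neq uw1 => ->; rewrite mul0r eq_sym oner_neq0.
(* The rows of [lform aH *: V] lie in D(A), hence are combinations of the generators [C *m V]; the
   rows of [V] are independent. *)
have [E EC] : exists E, E *m C = (lform aH)%:M.
  have [|E defE] := @rows_choice _ _ _ _ (lform aH *: V) G.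
    move=> i; apply: genG; apply: logA.
      by rewrite -mul_scalar_mx row_mul; apply: logmxM.
    move=> j; rewrite -row_mul -scalemxAl !mxE.
    exact/divides_mulr/divides_refl.
  exists E; apply: (lfree_inj lfreeV).
  by rewrite -mulmxA -defG -defE mul_scalar_mx.
pose Cr := map_mx (lsub P) C; pose Er := map_mx (lsub P) E.
have ev_res p q (M : 'M_(p, q)) : ev (map_mx (lsub P) M) = ev M.
  by apply/matrixP=> i j; rewrite !mxE lsub_mcoeff0.
have T0 : terao_poly P A0 R0 != 0.
  rewrite /terao_poly prodf_seq_neq0; apply/allP=> b bR /=.
  by rewrite expf_neq0 // lform_eq0 (nzR aH0 aHP rankP notH subR).
(* The generators send [aH] to multiples of itself, which vanish on H; Terao's polynomial then
   cancels. *)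
have Cf : Cr *m f = 0.
  apply: (scalemx_inj T0); rewrite scalemxAr -def_f mulmxA -map_mxM -defG scaler0.
  apply/matrixP=> i j; rewrite ord1 -(map_res_cmx P) -map_mxM mxE [RHS]mxE.
  by apply: (res_divides aHP); apply: logG.
have ECr : Er *m Cr = 0.
  by rewrite -map_mxM EC map_scalar_mx /= (res_lform_aH aHP) raddf0.
(* A lift of the syzygy to S gives a derivation in D(A), hence a combination of the generators,
   whose coefficients are then restricted to H. *)
have genC (v : 'rV_n) : v *m f = 0 -> exists z : 'rV_m, v = z *m Cr.
  move=> vf; pose v' := map_mx (lsub (pinvmx P)) v.
  have def_v : v = map_mx (lsub P) v'.
    by apply/matrixP=> i j; rewrite !mxE (res_lift rankP).
  have [|z def_z] := genG (v' *m V).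
    apply: logA; first exact: logmxM.
    move=> i; apply: (res_eq0 aH0 aHP rankP).
    have -> : lsub P ((v' *m V *m cmx aH^T) i 0)
        = (v *m (map_mx (lsub P) V *m cmx aH^T)) i 0.
      by rewrite def_v -(map_res_cmx P) -!map_mxM mulmxA [RHS]mxE.
    by rewrite def_f -scalemxAr vf scaler0 mxE.
  exists (map_mx (lsub P) z); rewrite -map_mxM def_v; congr map_mx.
  by apply: (lfree_inj lfreeV); rewrite def_z defG mulmxA.
have := rank_linear_multiple aH0 EC.
rewrite -(ev_res _ _ C) -(ev_res _ _ E) => rk.
(* Here e = l - 2, so in the second case the rank of E(0) is at least l - (e - 1) = 3; the bound m
   <= l + 2 reads m <= k + 3. *)
have [le_e|lt_e] := leqP e (\rank (ev Cr)).
  have [Z freeZ] := row_free_pick le_e.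
  apply: (saturated_koszul f0 kapK (F1 := cmx Z *m Cr)).
    by rewrite -mulmxA Cf mulmx0.
  by rewrite map_mxM ev_cmx.
apply: (saturated_generators f0 kapK Cf ECr genC); last first.
  by move: le_m; rewrite /k; lia.
by move: rk lt_e; rewrite -/Cr -/Er /n /k; lia.
Qed.
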